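(* The 8-element set $\{0,1,2,3,4,5,6,7\}$ is extreme in $\mathbb Z_9$.
   Context: $\mathbb Z_n$ denotes the cyclic group of order $n$. For a finite abelian group $G$ with dual group $\Gamma$ and a complex measure $\mu$ on $G$: $\|\mu\|=\sum_{x\in G}|\mu(\{x\})|$, $\widehat\mu(\gamma)=\sum_{x\in G}\overline{\gamma(x)}\,\mu(\{x\})$ for $\gamma\in\Gamma$, and $\|\widehat\mu\|_\infty=\max_\gamma|\widehat\mu(\gamma)|$. A non-zero measure $\mu$ on $G$ is extreme if $\|\widehat\mu\|_\infty=\|\mu\|/\sqrt{\#\mathrm{supp}\,\mu}$. A set $E\subset G$ is extreme if it is the support of an extreme measure on $G$. *)

(* Defs.v *)
From HB Require Import structures.
From mathcomp Require Import all_boot all_order all_algebra.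
From mathcomp Require Import complex.
From mathcomp Require Import mathcomp_extra boolp classical_sets functions cardinality reals.

Set Implicit Arguments.
Unset Strict Implicit.
Unset Printing Implicit Defensive.
Import Order.TTheory GRing.Theory Num.Theory.
Import ComplexField.Normc.
Local Open Scope ring_scope.
Local Open Scope complex_scope.

(* [normc : R[i] -> R] is the modulus with values in the reals, whereas the
   generic norm [`|z|] of [z : R[i]] lies in [R[i]]. *)

(* A complex measure [mu] on a finite group is given by its point masses
   [mu x], standing for mu({x}). *)
Section ExtremeMeasures.
Variables (R : realType) (G : finZmodType).
Implicit Types (mu gamma : G -> R[i]).

Definition dual_group gamma : Prop :=
  (forall x, normc (gamma x) = 1) /\
  (forall x y, gamma (x + y) = gamma x * gamma y).

Definition total_norm mu : R := \sum_x normc (mu x).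

Definition fourier mu gamma : R[i] := \sum_x (gamma x)^* * mu x.

(* The dual group is finite, so this supremum is a maximum: see
   [fourier_normP]. *)
Definition fourier_norm mu : R :=
  sup [set normc (fourier mu gamma) | gamma in dual_group]%classic.

Definition msupp mu : {set G} := [set x | mu x != 0].

Definition extreme_measure mu : Prop :=
  (exists x, mu x != 0) /\
  fourier_norm mu = total_norm mu / Num.sqrt #|msupp mu|%:R.

Definition extreme_set (E : {set G}) : Prop :=
  exists mu, extreme_measure mu /\ msupp mu = E.

End ExtremeMeasures.

Section Maximum.
Variables (R : realType) (G : finZmodType).
Implicit Types (mu gamma : G -> R[i]).

Lemma dual_group1 : dual_group (fun _ : G => 1 : R[i]).
Proof. by split=> [x|x y]; rewrite ?mulr1 // normc1. Qed.

Lemma dual_group_exp gamma x : dual_group gamma -> gamma x ^+ #|G| = 1.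
Proof.
move=> [g1 gD].
have nz y : gamma y != 0.
  by apply/eqP => g0; have /eqP := g1 y; rewrite g0 normc0 eq_sym oner_eq0.
have prod_nz : \prod_y gamma y != 0 by apply/prodf_neq0.
apply: (mulIf prod_nz); rewrite mul1r.
have -> : gamma x ^+ #|G| = \prod_(y : G) gamma x by rewrite prodr_const.
rewrite -big_split /= [RHS](reindex_inj (addrI x)) /=.
by apply: eq_bigr => y _; rewrite gD.
Qed.

Lemma finite_dual_group :
  finite_set [set gamma : G -> R[i] | dual_group gamma]%classic.
Proof.
have [s sE] := closed_field_poly_normal ('X^#|G| - 1%:P : {poly R[i]}).
have G0 : (0 < #|G|)%N by apply/card_gt0P; exists 0.
have in_s gamma x : dual_group gamma -> gamma x \in s.
  move=> /(@dual_group_exp _ x) gx.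
  rewrite -root_prod_XsubC.
  move: sE; rewrite lead_coefXnsubC // scale1r => <-.
  by rewrite /root !hornerE gx subrr.
pose f (h : {ffun G -> 'I_(size s)}) : G -> R[i] := fun x => s`_(h x).
apply: (@sub_finite_set _ _ (f @` setT)%classic); last first.
  by apply: finite_image; exact: finite_finset.
move=> gamma dg.
have lt_s x : (index (gamma x) s < size s)%N by rewrite index_mem in_s.
exists [ffun x => Ordinal (lt_s x)] => //.
by apply/funext => x; rewrite /f ffunE /= nth_index // in_s.
Qed.

Lemma fourier_normP mu :
  (exists2 gamma, dual_group gamma & fourier_norm mu = normc (fourier mu gamma)) /\
  (forall gamma, dual_group gamma -> normc (fourier mu gamma) <= fourier_norm mu).
Proof.
pose A : set R := [set normc (fourier mu gamma) | gamma in @dual_group R G]%classic.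
have [m Am ubm] : exists2 m, A m & (forall z, A z -> z <= m).
  have /finite_seqP[t At] : finite_set A.
    by apply: finite_image; exact: finite_dual_group.
  have memX z : A z <-> z \in t by rewrite At.
  have : A (normc (fourier mu (fun=> 1))).
    by exists (fun=> 1) => //; exact: dual_group1.
  move=> /memX; move: (normc _) => x0 x0t.
  have [m mt mub] : exists2 m, m \in t & {in t, forall z, z <= m}.
    elim: t {At memX} x0 x0t => // a [|b t] IH x0 _.
      by exists a; rewrite ?mem_head // => z; rewrite inE => /eqP->.
    have [m mt mub] := IH b (mem_head _ _).
    have [am|/ltW ma] := leP a m.
      by exists m; [rewrite inE mt orbT|move=> z; rewrite inE => /predU1P[->//|/mub]].
    exists a; rewrite ?mem_head // => z; rewrite inE => /predU1P[->//|/mub].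
    by move/le_trans; apply.
  by exists m => [|z /memX /mub //]; exact/memX.
have supA : fourier_norm mu = m.
  apply/eqP; rewrite eq_le; apply/andP; split.
    by apply: ge_sup => [|z /ubm //]; exists m.
  by apply: ub_le_sup => //; exists m => z /ubm.
rewrite supA; split.
  by case: Am => gamma dg <-; exists gamma.
by move=> gamma dg; apply: ubm; exists gamma.
Qed.

End Maximum.

(* Main.v *)
Require Import Defs.
From mathcomp Require Import all_boot all_order all_algebra.
From mathcomp Require Import complex.
From mathcomp Require Import reals.
Import Order.TTheory GRing.Theory Num.Theory.
Import ComplexField.Normc.
Local Open Scope ring_scope.

(** Call a measure flat when its nonzero masses all have modulus 1.  The square
    modulus of a Fourier transform is the transform of the autocorrelation
    [k |-> \sum_x mu x * (mu (x + k))^*].  If a flat measure has autocorrelation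
    zero away from 0, then its transform has constant modulus sqrt N, where N is
    the size of the support; as its total norm is N, it is extreme
    ([extreme_of_perfect_autocorrelation]).

    It remains to find such a measure on Z/9 vanishing exactly at 8.  Let b be an
    element of order 9 in the field with 64 elements, Tr the trace to the field
    F with 8 elements, and chi a nontrivial character of the group F^*, which is
    cyclic of order 7; extend chi by 0 at 0.  Put a(i) = chi (Tr (b^i)).  For
    i in Z/9 the only zero is at i = 0, since Tr (b^i) = b^i + b^(-i).  For
    k <> 0 the pair (Tr y, Tr (b^k y)) runs over F x F as y runs over the field
    with 64 elements, so the autocorrelation of a at k is a multiple of
    |\sum_(c in F) chi c|^2 = 0.  The identities a(2i) = a(i)^2,
    a(-i) = a(i) and a(3) = 1 (as Tr (b^3) = 1) give, with w = a(1) a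
    primitive seventh root of unity, the exponents 1, 2, 0, 4, 4, 0, 2, 1 for
    a(1), ..., a(8).  The measure below is x |-> a(x + 1).

    In terms of the exponents alone: for each k <> 0 the seven defined
    differences of exponents at x and x + k represent every class modulo 7
    exactly once, so the autocorrelation is the sum of all seventh roots of
    unity.  That finite property is checked by computation
    ([exponent_differences]). *)

(** * Perfect autocorrelation *)

Section Autocorrelation.
Variables (R : realType) (G : finZmodType).
Implicit Types (mu gamma : G -> R[i]).

Definition autocorrelation mu (k : G) : R[i] :=
  \sum_x mu x * Num.conj (mu (x + k)).

Lemma normc_nneg (z : R[i]) : 0 <= normc z.
Proof. by case: z => a b; apply: sqrtr_ge0. Qed.

Lemma normc_conjM (z : R[i]) : z * Num.conj z = ((normc z) ^+ 2)%:C%C.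
Proof. by rewrite -normCK -[`|z|]/((normc z)%:C)%C -rmorphXn. Qed.

Lemma dual_group_conjM gamma x :
  dual_group gamma -> Num.conj (gamma x) * gamma x = 1.
Proof. by case=> g1 _; rewrite mulrC normc_conjM g1 expr1n. Qed.

(** Substituting [y = x + k] in the double sum for the square modulus. *)
Lemma normc_fourier_sqr mu gamma : dual_group gamma ->
  ((normc (fourier mu gamma)) ^+ 2)%:C%C =
  \sum_k gamma k * autocorrelation mu k.
Proof.
move=> dg; rewrite -normc_conjM /fourier rmorph_sum mulr_suml.
under [RHS]eq_bigr => k _ do rewrite mulr_sumr.
rewrite exchange_big /=; apply: eq_bigr => x _.
rewrite mulr_sumr (reindex_inj (addrI x)) /=; apply: eq_bigr => k _.
rewrite rmorphM /= conjCK dg.2 mulrACA (mulrA _ (gamma x)).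
by rewrite dual_group_conjM // mul1r.
Qed.

Lemma dual_group0 gamma : dual_group gamma -> gamma 0 = 1.
Proof.
move=> dg; have := dual_group_conjM gamma 0 dg.
by rewrite -{2}[0]addr0 dg.2 mulrA dual_group_conjM // mul1r.
Qed.

Lemma sum_normcX_flat mu n : (0 < n)%N ->
  (forall x, mu x != 0 -> normc (mu x) = 1) ->
  \sum_x normc (mu x) ^+ n = #|msupp mu|%:R.
Proof.
move=> n0 flat; rewrite -sum1_card natr_sum big_mkcond [RHS]big_mkcond /=.
apply: eq_bigr => x _; rewrite inE; case: eqVneq => [->|/flat ->].
  by rewrite normc0 expr0n eqn0Ngt n0.
by rewrite expr1n.
Qed.

(** In the expansion over [k] only [k = 0] survives, with coefficient
    [gamma 0 = 1] and autocorrelation equal to the size of the support. *)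
Lemma normc_fourier_flat mu gamma :
  (forall x, mu x != 0 -> normc (mu x) = 1) ->
  (forall k, k != 0 -> autocorrelation mu k = 0) ->
  dual_group gamma -> normc (fourier mu gamma) = Num.sqrt #|msupp mu|%:R.
Proof.
move=> flat perfect dg.
suff <- : normc (fourier mu gamma) ^+ 2 = #|msupp mu|%:R.
  by rewrite sqrtr_sqr ger0_norm // normc_nneg.
apply: (@complexI R); rewrite normc_fourier_sqr //.
rewrite (bigD1 0) //= big1 => [|k /perfect ->]; last by rewrite mulr0.
rewrite addr0 dual_group0 // mul1r -(sum_normcX_flat mu 2%N) // rmorph_sum.
by apply: eq_bigr => x _; rewrite addr0 normc_conjM.
Qed.

Lemma extreme_of_perfect_autocorrelation mu :
  (exists x, mu x != 0) ->
  (forall x, mu x != 0 -> normc (mu x) = 1) ->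
  (forall k, k != 0 -> autocorrelation mu k = 0) ->
  extreme_measure mu.
Proof.
move=> nz flat perfect; split=> //.
have [[gamma dg ->] _] := fourier_normP mu.
rewrite (normc_fourier_flat _ _ flat perfect dg).
have -> : total_norm mu = #|msupp mu|%:R by exact: (sum_normcX_flat mu 1%N).
have N0 : 0 < #|msupp mu|%:R :> R.
  by rewrite ltr0n; apply/card_gt0P; case: nz => x; exists x; rewrite inE.
by rewrite -{2}(sqr_sqrtr (ltW N0)) expr2 mulfK // gt_eqF // sqrtr_gt0.
Qed.

End Autocorrelation.

(** * A measure with values in the seventh roots of unity *)

Section SeventhRoots.
Variable R : realType.

(** The root is taken of 1 + X + ... + X^6 rather than of X^7 - 1, which excludes
    [w = 1]; the vanishing sum is the form in which primitivity is used. *)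
Lemma exists_seventh_root : exists w : R[i], \sum_(0%N <= i < 7%N) w ^+ i = 0.
Proof.
have [w wE] := @solve_monicpoly R[i] 6%N (fun=> -1) isT.
exists w; rewrite big_nat_recr //= wE big_mkord -big_split big1 // => i _.
by rewrite /= mulN1r addrN.
Qed.

Variable w : R[i].
Hypothesis sum_w : \sum_(0%N <= i < 7%N) w ^+ i = 0.

Lemma seventh_root_exp : w ^+ 7%N = 1.
Proof. by apply/eqP; rewrite -subr_eq0 subrX1 -(big_mkord xpredT) sum_w mulr0. Qed.

Lemma normc_seventh_root : normc w = 1.
Proof.
apply/eqP; rewrite -(@pexpr_eq1 _ _ 7%N) ?normc_nneg //.
apply/eqP/(@complexI R); rewrite rmorphXn /= -[((normc w)%:C)%C]/(`|w|).
by rewrite -normrX seventh_root_exp normr1.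
Qed.

Lemma conj_seventh_root : Num.conj w = w ^+ 6%N.
Proof.
have := normc_conjM _ w; rewrite normc_seventh_root expr1n => wJ.
by rewrite -[LHS]mul1r -seventh_root_exp exprSr -mulrA wJ mulr1.
Qed.

Definition exponent (n : nat) : nat := nth 0%N [:: 1; 2; 0; 4; 4; 0; 2; 1]%N n.

Definition mass (n : nat) : R[i] := if n == 8%N then 0 else w ^+ exponent n.

Definition root_measure (x : 'Z_9) : R[i] := mass x.

Lemma normc_mass n : n != 8%N -> normc (mass n) = 1.
Proof.
rewrite /mass => /negPf->; apply: (@complexI R).
rewrite -[((normc _)%:C)%C]/(`|w ^+ exponent n|) normrX.
by rewrite -[`|w|]/((normc w)%:C)%C normc_seventh_root expr1n.
Qed.

Lemma mass_neq0 n : (mass n != 0) = (n != 8%N).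
Proof.
have [->|n8] := eqVneq n 8%N; first by rewrite /mass /= eqxx.
apply/eqP => m0; have /eqP := normc_mass n n8.
by rewrite m0 normc0 eq_sym oner_eq0.
Qed.

(** Multiplication by 6 is negation modulo 7, so the entries are the differences
    of exponents at distance [k], reduced modulo 7; the filter keeps the [x] for
    which both [x] and [x + k] avoid the zero at 8.  This is the relative
    difference set property of the exponents. *)
Lemma exponent_differences k : (0 < k < 9)%N ->
  perm_eq [seq ((exponent x + 6 * exponent ((x + k) %% 9)) %% 7)%N
          | x <- index_iota 0%N 9%N & (x != 8%N) && ((x + k) %% 9 != 8)%N]
          (index_iota 0%N 7%N).
Proof. by do 9![case: k => [|k] //]. Qed.

Lemma autocorrelation_root_measure k :
  k != 0 -> autocorrelation R _ root_measure k = 0.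
Proof.
move=> k0; have k9 : (0 < k < 9)%N by rewrite lt0n k0 /= ltn_ord.
rewrite -sum_w -(perm_big _ (exponent_differences k k9)) big_map big_filter.
rewrite /autocorrelation [RHS]big_mkcond [RHS]big_mkord.
apply: eq_bigr => x _; rewrite /root_measure /mass.
rewrite -[nat_of_ord (x + k)]/((x + k) %% 9)%N.
case: (_ == 8%N); first by rewrite mul0r.
case: (_ == 8%N); first by rewrite conjC0 mulr0.
by rewrite rmorphXn /= conj_seventh_root -exprM -exprD expr_mod // seventh_root_exp.
Qed.

End SeventhRoots.

Theorem proposition7p17 (R : realType) :
  extreme_set R [set (0 : 'Z_9); 1; 2; 3; 4; 5; 6; 7].
Proof.
have [w sum_w] := exists_seventh_root R.
exists (root_measure R w); split.
  apply: extreme_of_perfect_autocorrelation.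
  - by exists 0; rewrite mass_neq0.
  - by move=> x; rewrite mass_neq0 //; apply: normc_mass.
  - exact: autocorrelation_root_measure.
apply/setP => x; rewrite !inE mass_neq0 //.
by case: x; do 9![case=> //].
Qed.
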